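(* Let $(A,\le)$ be a properly stratified algebra, let $T$ be the basic tilting module with $\mathrm{add}(T)=\mathcal F(\Delta)\cap\mathcal F(\overline{\nabla})$ and let $S$ be the basic cotilting module with $\mathrm{add}(S)=\mathcal F(\nabla)\cap\mathcal F(\overline{\Delta})$. Suppose that $T=S$ (up to isomorphism). Then $\mathrm{proj.dim}(T)+\mathrm{inj.dim}(T)$ is finite and is an upper bound for the finitistic dimension of $A$.
   Context: Setting: $R$ is a commutative Artin ring, $A$ is a basic Artin $R$-algebra, and $A\text{-mod}$ is the category of finitely generated left $A$-modules. Fix an ordered complete set $e_1,\dots,e_n$ of primitive orthogonal idempotents of $A$; put $\Lambda=\{1,\dots,n\}$ with its natural order $\le$. For $i\in\Lambda$, $P(i)=Ae_i$, $E(i)$ is the simple top of $P(i)$, and $I(i)$ is the injective envelope of $E(i)$. The standard module $\Delta(i)$ is the maximal factor module of $P(i)$ having no composition factor $E(j)$ with $j>i$; the proper standard module $\overline{\Delta}(i)$ is the maximal factor module of $\Delta(i)$ in which $E(i)$ occurs as a composition factor with multiplicity exactly $1$. Dually, the costandard module $\nabla(i)$ is the maximal submodule of $I(i)$ having no composition factor $E(j)$ with $j>i$, and the proper costandard module $\overline{\nabla}(i)$ is the maximal submodule of $\nabla(i)$ in which $E(i)$ occurs with multiplicity exactly $1$. For a class $\Theta$ of $A$-modules, $\mathcal F(\Theta)$ is the full subcategory of $A\text{-mod}$ of modules having a finite filtration whose successive factors are isomorphic to objects of $\Theta$; $\Delta,\overline{\Delta},\nabla,\overline{\nabla}$ also denote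 the corresponding families indexed by $\Lambda$. $(A,\le)$ is properly stratified if ${}_AA\in\mathcal F(\Delta)$ and ${}_AA\in\mathcal F(\overline{\Delta})$. For such an algebra the (generalized) tilting module $T$ and the (generalized) cotilting module $S$ of the claim exist. The finitistic dimension of $A$ is the supremum of $\mathrm{proj.dim}(X)$ over all $X\in A\text{-mod}$ with finite projective dimension. *)

(* Defs.v *)
From HB Require Import structures.
From mathcomp Require Import all_boot all_order all_algebra.

Set Implicit Arguments.
Unset Strict Implicit.
Unset Printing Implicit Defensive.

Import GRing.Theory.
Local Open Scope ring_scope.

(* Submodules, factor modules and exact sequences of left A-modules are given
   by injective and surjective linear maps, so every class of modules below is
   closed under isomorphism.  A-mod consists of the M with [fingen M]. *)

Section Modules.
Variable A : pzRingType.
Implicit Types M N K X Y Q E I P S T : lmodType A.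

Definition surj (U V : Type) (f : U -> V) : Prop := forall y, exists x, f x = y.

Definition zero_mod M : Prop := forall x : M, x = 0.

Definition iso M N : Prop := exists f : {linear M -> N}, bijective f.

Definition ses N M Q (f : {linear N -> M}) (g : {linear M -> Q}) : Prop :=
  [/\ injective f, surj g & forall x, g x = 0 <-> exists z, f z = x].

Definition short_exact N M Q : Prop :=
  exists (f : {linear N -> M}) (g : {linear M -> Q}), ses f g.

Definition fingen M : Prop :=
  exists (k : nat) (v : 'I_k -> M),
    forall x, exists a : 'I_k -> A, x = \sum_i a i *: v i.

Definition simple_mod M : Prop :=
  ~ zero_mod M /\
  forall N (u : {linear N -> M}), injective u -> zero_mod N \/ surj u.

Definition projective_mod P : Prop :=
  forall X Y (g : {linear X -> Y}) (f : {linear P -> Y}), surj g ->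
    exists h : {linear P -> X}, forall x, g (h x) = f x.

Definition injective_mod I : Prop :=
  forall X Y (u : {linear X -> Y}) (f : {linear X -> I}), injective u ->
    exists h : {linear Y -> I}, forall x, h (u x) = f x.

Definition essential_mono E I (u : {linear E -> I}) : Prop :=
  injective u /\
  forall N (v : {linear N -> I}), injective v -> ~ zero_mod N ->
    exists x y, v x = u y /\ v x <> 0.

Definition injective_envelope E I : Prop :=
  injective_mod I /\ exists u : {linear E -> I}, essential_mono u.

(* E = M / rad M.  The radical is the intersection of the maximal submodules,
   that is, of the kernels of the linear maps from M to simple modules. *)
Definition is_top M E : Prop :=
  exists p : {linear M -> E}, surj p /\
    forall x, p x = 0 <->
      forall S (f : {linear M -> S}), simple_mod S -> f x = 0.

(* M has a composition series in which exactly k factors are isomorphic to E;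
   by Jordan-Hoelder, k depends only on E and M. *)
Inductive comp_mult E : lmodType A -> nat -> Prop :=
| CompMult0 M : zero_mod M -> comp_mult E M 0
| CompMultIn N M Q k : short_exact N M Q -> simple_mod Q -> iso Q E ->
    comp_mult E N k -> comp_mult E M k.+1
| CompMultOut N M Q k : short_exact N M Q -> simple_mod Q -> ~ iso Q E ->
    comp_mult E N k -> comp_mult E M k.

Definition comp_factor E M : Prop := exists k, comp_mult E M k.+1.

(* Maximality is with respect to the ordering of factor modules (resp.
   submodules) of M; it is required in the sense of a greatest element. *)
Definition max_factor (C : lmodType A -> Prop) M Q : Prop :=
  exists p : {linear M -> Q}, [/\ surj p, C Q &
    forall X (q : {linear M -> X}), surj q -> C X ->
      exists h : {linear Q -> X}, forall x, h (p x) = q x].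

Definition max_sub (C : lmodType A -> Prop) M N : Prop :=
  exists u : {linear N -> M}, [/\ injective u, C N &
    forall X (v : {linear X -> M}), injective v -> C X ->
      exists h : {linear X -> N}, forall x, u (h x) = v x].

Inductive filtered (Theta : lmodType A -> Prop) : lmodType A -> Prop :=
| Filtered0 M : zero_mod M -> filtered Theta M
| FilteredS N M Q : short_exact N M Q -> Theta Q -> filtered Theta N ->
    filtered Theta M.

Definition add_class T M : Prop :=
  exists (m : nat) Y, iso (M * Y)%type {ffun 'I_m -> T}.

Definition indecomposable M : Prop :=
  ~ zero_mod M /\ forall X Y, iso M (X * Y)%type -> zero_mod X \/ zero_mod Y.

Definition is_direct_sum k (N : 'I_k -> lmodType A) M : Prop :=
  exists u : forall i, {linear N i -> M},
    (forall x, exists y : forall i, N i, x = \sum_i u i (y i)) /\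
    (forall y : forall i, N i, \sum_i u i (y i) = 0 -> forall i, y i = 0).

Definition basic_mod M : Prop :=
  exists k (N : 'I_k -> lmodType A),
    [/\ forall i, indecomposable (N i),
        forall i j, i != j -> ~ iso (N i) (N j)
      & is_direct_sum N M].

(* Exact 0 -> C_d -> ... -> C_0 -> M -> 0 with all C_i in C. *)
Fixpoint resolution_by (C : lmodType A -> Prop) (d : nat) M : Prop :=
  if d is d'.+1 then
    exists N K, [/\ short_exact K N M, C N & resolution_by C d' K]
  else C M.

(* Exact 0 -> M -> C_0 -> ... -> C_d -> 0 with all C_i in C. *)
Fixpoint coresolution_by (C : lmodType A -> Prop) (d : nat) M : Prop :=
  if d is d'.+1 then
    exists N K, [/\ short_exact M N K, C N & coresolution_by C d' K]
  else C M.

(* Resolutions are taken in A-mod. *)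
Definition projdim_le M (d : nat) : Prop :=
  resolution_by (fun P => fingen P /\ projective_mod P) d M.

Definition injdim_le M (d : nat) : Prop :=
  coresolution_by (fun I => fingen I /\ injective_mod I) d M.

Definition projdim M (d : nat) : Prop :=
  projdim_le M d /\ forall k, projdim_le M k -> (d <= k)%N.

Definition injdim M (d : nat) : Prop :=
  injdim_le M d /\ forall k, injdim_le M k -> (d <= k)%N.

Definition findim_ub (b : nat) : Prop :=
  forall X d, fingen X -> projdim X d -> (d <= b)%N.

(* The supremum is finite and equal to d. *)
Definition findim (d : nat) : Prop :=
  findim_ub d /\ forall b, findim_ub b -> (d <= b)%N.

Definition is_proj_resolution X (P : nat -> lmodType A)
    (d : forall i, {linear P i.+1 -> P i}) (aug : {linear P 0%N -> X}) : Prop :=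
  [/\ forall i, projective_mod (P i),
      surj aug,
      forall x, aug x = 0 <-> exists z, d 0%N z = x
    & forall i x, d i x = 0 <-> exists z, d i.+1 z = x].

(* Ext^(k+1)(X, Y) = 0: Hom(P_*, Y) is exact in degree k+1 for the projective
   resolutions P_* of X. *)
Definition extS_vanish (k : nat) X Y : Prop :=
  forall (P : nat -> lmodType A) (d : forall i, {linear P i.+1 -> P i})
    (aug : {linear P 0%N -> X}), is_proj_resolution d aug ->
  forall f : {linear P k.+1 -> Y}, (forall z, f (d k.+1 z) = 0) ->
    exists g : {linear P k -> Y}, forall z, f z = g (d k z).

End Modules.

Section Algebra.
Variable A : nzRingType.

(* Generalized tilting in the sense of Miyashita: the projective dimension is
   finite, not necessarily at most 1.  Cotilting is dual; the injective
   cogenerator is replaced by all injective objects of A-mod. *)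
Definition tilting (T : lmodType A) : Prop :=
  [/\ fingen T,
      exists d, projdim_le T d,
      forall k, extS_vanish k T T
    & exists r, coresolution_by (add_class T) r A^o].

Definition cotilting (S : lmodType A) : Prop :=
  [/\ fingen S,
      exists d, injdim_le S d,
      forall k, extS_vanish k S S
    & forall I : lmodType A, fingen I -> injective_mod I ->
        exists r, resolution_by (add_class S) r I].

Definition primitive_idempotent (x : A) : Prop :=
  [/\ x != 0, x * x = x &
    forall f g : A, f * f = f -> g * g = g -> f * g = 0 -> g * f = 0 ->
      x = f + g -> f = 0 \/ g = 0].

Variables (n : nat) (e : 'I_n -> A).

Definition complete_primitive_orthogonal : Prop :=
  [/\ forall i, primitive_idempotent (e i),
      forall i j, i != j -> e i * e j = 0
    & \sum_i e i = 1].

(* P(i), E(i), I(i) and the (proper) (co)standard modules are determined up to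
   isomorphism; each is given by the predicate of being such a module.  The
   indices i < n stand for 1, ..., n. *)
Definition is_P (i : 'I_n) (P : lmodType A) : Prop :=
  exists f : {linear P -> A^o}, injective f /\
    forall a : A, (exists x, f x = a) <-> (exists b : A, a = b * e i).

Definition is_E (i : 'I_n) (E : lmodType A) : Prop :=
  simple_mod E /\ exists P, is_P i P /\ is_top P E.

Definition is_I (i : 'I_n) (I : lmodType A) : Prop :=
  exists E, is_E i E /\ injective_envelope E I.

Definition basic_algebra : Prop :=
  forall i j P Q, i != j -> is_P i P -> is_P j Q -> ~ iso P Q.

Definition no_factor_above (i : 'I_n) (M : lmodType A) : Prop :=
  forall (j : 'I_n) E, (i < j)%N -> is_E j E -> ~ comp_factor E M.

Definition factor_once (i : 'I_n) (M : lmodType A) : Prop :=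
  exists E, is_E i E /\ comp_mult E M 1.

Definition standard (i : 'I_n) (M : lmodType A) : Prop :=
  exists P, is_P i P /\ max_factor (no_factor_above i) P M.

Definition proper_standard (i : 'I_n) (M : lmodType A) : Prop :=
  exists D, standard i D /\ max_factor (factor_once i) D M.

Definition costandard (i : 'I_n) (M : lmodType A) : Prop :=
  exists I, is_I i I /\ max_sub (no_factor_above i) I M.

Definition proper_costandard (i : 'I_n) (M : lmodType A) : Prop :=
  exists N, costandard i N /\ max_sub (factor_once i) N M.

Definition filtered_by (Theta : 'I_n -> lmodType A -> Prop) (M : lmodType A) : Prop :=
  fingen M /\ filtered (fun Q => exists i, Theta i Q) M.

Definition properly_stratified : Prop :=
  filtered_by standard A^o /\ filtered_by proper_standard A^o.

End Algebra.

Definition is_ideal (R : comNzRingType) (I : R -> Prop) : Prop :=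
  [/\ I 0, forall x y, I x -> I y -> I (x + y) & forall a x, I x -> I (a * x)].

Definition artinian (R : comNzRingType) : Prop :=
  forall I : nat -> R -> Prop,
    (forall k, is_ideal (I k)) ->
    (forall k x, I k.+1 x -> I k x) ->
    exists k0, forall k x, (k0 <= k)%N -> I k0 x -> I k x.

Definition artin_algebra (R : comNzRingType) (A : algType R) : Prop :=
  artinian R /\ @fingen R A.

(* Main.v *)
(* T is tilting of projective dimension p and, being isomorphic to S, has finite
   injective dimension q.  Since T has no self-extensions, a coresolution of A
   by add T can be cut down to length at most p, so Ext^k(X, A) = 0 for all X
   and all k > p + q.  On the other hand, if X has finite projective dimension
   d > 0 then Ext^d(X, A) <> 0, for otherwise the last step of a projective
   resolution of length d would split. *)

Require Import Defs.
From HB Require Import structures.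
From mathcomp Require Import all_boot all_order all_algebra.
From Stdlib Require Import Classical_Prop.

Set Implicit Arguments.
Unset Strict Implicit.
Unset Printing Implicit Defensive.

Import GRing.Theory.
Local Open Scope ring_scope.

(** [P] is not assumed decidable, as for bounds on homological dimensions, so the least element
    comes from classical logic. *)
Lemma ex_min (P : nat -> Prop) :
  (exists k, P k) -> exists k, P k /\ forall j, P j -> (k <= j)%N.
Proof.
move=> [k Pk]; apply: NNPP => nomin.
suff notP j : forall i, (i <= j)%N -> ~ P i by exact: (notP k k).
elim: j => [|j IHj] i lij Pi; apply: nomin; exists i; split => // m Pm.
  by rewrite (leq_trans lij).
by rewrite leqNgt; apply/negP => lmi; apply: (IHj m) => //; rewrite -ltnS (leq_trans lmi).
Qed.

(** * Linear maps: factorizations, retracts and splittings *)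

Section LinearMaps.
Variable A : pzRingType.
Implicit Types M N K X Y Z W V T : lmodType A.

Lemma linear_mk X Y (f : X -> Y) :
  linear f -> exists g : {linear X -> Y}, forall x, g x = f x.
Proof.
move=> linf.
pose mixin := GRing.isLinear.Build A X Y *:%R f linf.
pose g : {linear X -> Y} := HB.pack f mixin.
by exists g.
Qed.

Lemma factor_inj N M X (u : {linear N -> M}) (f : {linear X -> M}) :
  injective u -> (forall x, exists z, u z = f x) ->
  exists h : {linear X -> N}, forall x, u (h x) = f x.
Proof.
move=> inju imf.
(* The boolean equation lets [xchoose] pick preimages; they are unique because [u] is injective, and
   this makes the choice linear. *)
have imfb x : exists z, u z == f x by have [z <-] := imf x; exists z.
pose h x := xchoose (imfb x).
have uh x : u (h x) = f x by exact/eqP/(xchooseP (imfb x)).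
have [|g gE] := @linear_mk _ _ h.
  by move=> a x y; apply: inju; rewrite linearP !uh linearP.
by exists g => x; rewrite gE uh.
Qed.

Lemma factor_surj X Y Z (p : {linear X -> Y}) (f : {linear X -> Z}) :
  surj p -> (forall x, p x = 0 -> f x = 0) ->
  exists h : {linear Y -> Z}, forall x, h (p x) = f x.
Proof.
move=> surjp kerf.
have surjb y : exists x, p x == y by have [x <-] := surjp y; exists x.
pose s y := xchoose (surjb y).
have ps y : p (s y) = y by exact/eqP/(xchooseP (surjb y)).
(* The section [s] need not be linear, but [f \o s] is, because [f] is constant on the fibres of
   [p]. *)
have fE x y : p x = p y -> f x = f y.
  move=> pxy; apply/eqP; rewrite -subr_eq0 -linearB; apply/eqP/kerf.
  by rewrite linearB /= pxy subrr.
have [|h hE] := @linear_mk _ _ (fun y => f (s y)).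
  by move=> a x y; rewrite -linearP; apply: fE; rewrite linearP !ps.
by exists h => x; rewrite hE; apply: fE; rewrite ps.
Qed.

Lemma ses_comp0 N M Z (u : {linear N -> M}) (g : {linear M -> Z}) z :
  ses u g -> g (u z) = 0.
Proof. by move=> [_ _ ex]; apply/ex; exists z. Qed.

Definition retract M W : Prop :=
  exists (i : {linear M -> W}) (r : {linear W -> M}), forall x, r (i x) = x.

(** Membership in add(T) without naming a complement: only the two maps are needed to transfer
    vanishing and splitting. *)
Definition summand T M : Prop := exists m : nat, retract M {ffun 'I_m -> T}.

Lemma retract_trans M W V : retract M W -> retract W V -> retract M V.
Proof.
move=> [i [r ri]] [j [s sj]].
by exists (j \o i), (r \o s) => x /=; rewrite sj ri.
Qed.

Lemma retract_projective M W : retract M W -> projective_mod W -> projective_mod M.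
Proof.
move=> [i [r ri]] projW X Y g f surjg.
have [h hE] := projW _ _ g (f \o r) surjg.
by exists (h \o i) => x /=; rewrite hE /= ri.
Qed.

Lemma surj_fingen M W (g : {linear W -> M}) : surj g -> fingen W -> fingen M.
Proof.
move=> surjg [k [v gen]]; exists k, (fun i => g (v i)) => y.
have [x <-] := surjg y; have [a ->] := gen x; exists a.
by rewrite linear_sum; apply: eq_bigr => i _; rewrite linearZ.
Qed.

Lemma add_class_summand T M : add_class T M -> summand T M.
Proof.
move=> [m [Y [f [g fK gK]]]]; exists m.
have [|g' gE] := @linear_mk _ _ g.
  by move=> a x y; apply: (can_inj fK); rewrite linearP !gK.
have [|i iE] := @linear_mk M (M * Y)%type (fun x => (x, 0)).
  by move=> a x y; congr (_, _); rewrite /= scaler0 addr0.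
have [|r rE] := @linear_mk (M * Y)%type M (fun x => x.1) => //.
by exists (f \o i), (r \o g') => x /=; rewrite rE gE fK iE.
Qed.

Lemma fingen_projective_summand M :
  fingen M -> projective_mod M -> summand (A^o : lmodType A) M.
Proof.
move=> [m [v gen]] projM; exists m.
have [|r rE] := @linear_mk {ffun 'I_m -> A^o} M (fun h => \sum_i (h i : A) *: v i).
  move=> a x y; rewrite scaler_sumr -big_split; apply: eq_bigr => i _ /=.
  by rewrite !ffunE scalerDl scalerA.
have surjr : surj r.
  move=> x; have [a ->] := gen x; exists [ffun i => a i]; rewrite rE.
  by apply: eq_bigr => i _; rewrite ffunE.
by have [i iE] := projM _ _ r idfun surjr; exists i, r.
Qed.

(** The map [idfun \- (s \o g)] lands in the kernel of [g], so it factors through [u]; the factor is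
    the retraction. *)
Lemma retract_ses M W Z (u : {linear M -> W}) (g : {linear W -> Z})
    (s : {linear Z -> W}) :
  ses u g -> (forall z, g (s z) = z) -> retract M W.
Proof.
move=> sesu gs; have [inju _ ex] := sesu.
have [x|r rE] := @factor_inj M W W u (idfun \- (s \o g)) inju.
  by apply/ex; rewrite linearB /= gs subrr.
exists u, r => x; apply: inju; rewrite rE /= (ses_comp0 _ sesu) linear0 subr0 //.
Qed.

Lemma retract_ses_quotient M W Z (u : {linear M -> W}) (g : {linear W -> Z})
    (r : {linear W -> M}) :
  ses u g -> (forall x, r (u x) = x) -> retract Z W.
Proof.
move=> [inju surjg ex] ru.
have [x /ex[z <-]|s sE] := @factor_surj W Z W g (idfun \- (u \o r)) surjg.
  by rewrite /= ru subrr.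
exists s, g => z; have [x <-] := surjg z.
rewrite sE linearB /=; suff -> : g (u (r x)) = 0 by rewrite subr0.
by apply/ex; exists (r x).
Qed.

End LinearMaps.

(** * Vanishing of Ext and pieces of its long exact sequence *)

Section Ext.
Variable A : pzRingType.
Implicit Types M N K X Y Z W V T : lmodType A.
Implicit Types P : nat -> lmodType A.

(* Vanishing of Ext^(k+1)(X, Y), computed in one fixed resolution P of X. *)
Definition ext_vanish (P : nat -> lmodType A) (d : forall i, {linear P i.+1 -> P i})
    (k : nat) Y : Prop :=
  forall f : {linear P k.+1 -> Y}, (forall z, f (d k.+1 z) = 0) ->
    exists g : {linear P k -> Y}, forall z, f z = g (d k z).

(** Vanishing is applied to each coordinate of [i \o f]; the assembled cochain is then mapped back
    by [r]. *)
Lemma ext_vanish_summand P (d : forall i, {linear P i.+1 -> P i}) k T M :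
  summand T M -> ext_vanish d k T -> ext_vanish d k M.
Proof.
move=> [m [i [r ri]]] extT f fd.
have extj j : exists g : {linear P k -> T}, forall z, i (f z) j = g (d k z).
  have [|c cE] := @linear_mk A (P k.+1) T (fun z => i (f z) j).
    by move=> a x y; rewrite !linearP !ffunE.
  have [z|g gE] := extT c; first by rewrite cE fd linear0 ffunE.
  by exists g => z; rewrite -gE cE.
have [g gE] := fin_all_exists extj.
have [|h hE] := @linear_mk A (P k) {ffun 'I_m -> T} (fun z => [ffun j => g j z]).
  by move=> a x y; apply/ffunP => j; rewrite !ffunE linearP.
exists (r \o h) => z /=; rewrite -[LHS]ri hE; congr (r _).
by apply/ffunP => j; rewrite ffunE gE.
Qed.

(* The factorization of the differentials exhibits the syzygies as modules. *)
Definition good_resolution X (P : nat -> lmodType A)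
    (d : forall i, {linear P i.+1 -> P i}) (aug : {linear P 0%N -> X}) : Prop :=
  is_proj_resolution d aug /\
  forall k, exists K (p : {linear P k.+1 -> K}) (u : {linear K -> P k}),
    [/\ surj p, injective u & forall z, d k z = u (p z)].

(** A cocycle kills the kernel of [d k], so it factors through the image [K]; injectivity extends
    the factor along [u]. *)
Lemma ext_vanish_injective X P d (aug : {linear P 0%N -> X}) k I :
  good_resolution d aug -> injective_mod I -> ext_vanish d k I.
Proof.
move=> [[_ _ _ exd] /(_ k)[K [p [u [surjp inju dE]]]]] injI f fd.
have [x px|f' f'E] := @factor_surj A _ _ _ p f surjp.
  have /exd[z <-] : d k x = 0 by rewrite dE px linear0.
  exact: fd.
have [g gE] := injI _ _ u f' inju.
by exists g => z; rewrite dE gE f'E.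
Qed.

(** Exactness of Ext^(k+1)(X, Z) -> Ext^(k+2)(X, M) -> Ext^(k+2)(X, W), chased on cochains. *)
Lemma ext_vanish_sub X P d (aug : {linear P 0%N -> X}) k M W Z :
  is_proj_resolution d aug -> short_exact M W Z ->
  ext_vanish d k.+1 W -> ext_vanish d k Z -> ext_vanish d k.+1 M.
Proof.
move=> [projP _ _ exd] [u [g sesu]] extW extZ f fd.
have [inju surjg exu] := sesu.
have dd i z : d i (d i.+1 z) = 0 by apply/exd; exists z.
have [z|h hE] := extW (u \o f); first by rewrite /= fd linear0.
have [z|a aE] := extZ (g \o h).
  by rewrite /= -hE /=; exact: ses_comp0 sesu.
(* Subtracting [b \o d k] moves [h] into the kernel of [g] without changing [h \o d k.+1]. *)
have [b bE] := projP k _ _ g a surjg.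
have [x|c cE] := @factor_inj A _ _ _ u (h \- (b \o d k)) inju.
  by apply/exu; rewrite linearB /= bE -aE subrr.
exists c => z; apply: inju; rewrite cE /= dd linear0 subr0 -hE //.
Qed.

(** Exactness of Ext^(k+1)(X, W) -> Ext^(k+1)(X, Z) -> Ext^(k+2)(X, M). *)
Lemma ext_vanish_quotient X P d (aug : {linear P 0%N -> X}) k M W Z :
  is_proj_resolution d aug -> short_exact M W Z ->
  ext_vanish d k W -> ext_vanish d k.+1 M -> ext_vanish d k Z.
Proof.
move=> [projP _ _ exd] [u [g sesu]] extW extM f fd.
have [inju surjg exu] := sesu.
have dd i z : d i (d i.+1 z) = 0 by apply/exd; exists z.
have [h hE] := projP _ _ _ g f surjg.
have [x|c cE] := @factor_inj A _ _ _ u (h \o d k.+1) inju.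
  by apply/exu; rewrite /= hE fd.
have [z|b bE] := extM c; first by apply: inju; rewrite cE /= dd !linear0.
have [z|a aE] := extW (h \- (u \o b)).
  by rewrite /= -bE cE subrr.
exists (g \o a) => z; rewrite -hE /= -aE /= linearB /= (ses_comp0 _ sesu) subr0 //.
Qed.

(** The obstruction to lifting [f] along [g] lies in Ext^1(X, M), which has index [0] in
    [ext_vanish]. *)
Lemma ext_vanish_lift X P d (aug : {linear P 0%N -> X}) M W Z
    (u : {linear M -> W}) (g : {linear W -> Z}) (f : {linear X -> Z}) :
  is_proj_resolution d aug -> ses u g -> ext_vanish d 0 M ->
  exists h : {linear X -> W}, forall x, g (h x) = f x.
Proof.
move=> [projP surja exa exd] sesu extM.
have [inju surjg exu] := sesu.
have dd i z : d i (d i.+1 z) = 0 by apply/exd; exists z.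
have ad z : aug (d 0 z) = 0 by apply/exa; exists z.
have [h hE] := projP _ _ _ g (f \o aug) surjg.
have [x|c cE] := @factor_inj A _ _ _ u (h \o d 0) inju.
  by apply/exu; rewrite /= hE /= ad linear0.
have [z|b bE] := extM c; first by apply: inju; rewrite cE /= dd !linear0.
have [x /exa[z <-]|l lE] := @factor_surj A _ _ _ aug (h \- (u \o b)) surja.
  by rewrite /= -bE cE subrr.
exists l => x; have [y <-] := surja x.
by rewrite lE linearB /= hE (ses_comp0 _ sesu) subr0.
Qed.

(** * Dimension shifting along coresolutions *)

Lemma ext_vanish_coresolution X P d (aug : {linear P 0%N -> X}) C q r M :
  is_proj_resolution d aug ->
  (forall W k, C W -> (q <= k)%N -> ext_vanish d k W) ->
  coresolution_by C r M -> forall k, (q + r <= k)%N -> ext_vanish d k M.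
Proof.
move=> res extC; elim: r M => [|r IHr] M /=.
  by move=> CM k; rewrite addn0; exact: extC.
move=> [W [Z [sesM CW corZ]]] [|k]; rewrite addnS // ltnS => leqk.
(* Passing from the cosyzygy [Z] to [M] raises the degree by one, which accounts for the summand [r]
   in the bound. *)
apply: (ext_vanish_sub res sesM); last exact: IHr.
by apply: extC => //; rewrite (leq_trans _ (leqW leqk)) ?leq_addr.
Qed.

Lemma coresolution_by_mono (C C' : lmodType A -> Prop) r M :
  (forall W, C W -> C' W) -> coresolution_by C r M -> coresolution_by C' r M.
Proof.
move=> CC'; elim: r M => [|r IHr] M /=; first exact: CC'.
by move=> [W [Z [? ? ?]]]; exists W, Z; split; auto.
Qed.

(** Only [T] is resolved, so the identity of [Z] is lifted through the components [T -> Z] of the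
    retraction [r]; the lifts add up to a section of [g]. *)
Lemma ses_split_summand T P d (aug : {linear P 0%N -> T}) M W Z :
  is_proj_resolution d aug -> short_exact M W Z -> ext_vanish d 0 M ->
  summand T Z -> retract M W.
Proof.
move=> res [u [g sesu]] extM [m [i [r ri]]].
have lift j : exists h : {linear T -> W},
    forall x, g (h x) = r [ffun k => if k == j then x else 0].
  have [|rj rjE] := @linear_mk A T Z (fun x => r [ffun k => if k == j then x else 0]).
    move=> a x y; rewrite -linearP; congr (r _); apply/ffunP => k.
    by rewrite !ffunE; case: eqP => // _; rewrite scaler0 addr0.
  have [h hE] := ext_vanish_lift rj res sesu extM.
  by exists h => x; rewrite hE rjE.
have [h hE] := fin_all_exists lift.
have [|s sE] := @linear_mk A Z W (fun z => \sum_j h j (i z j)).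
  move=> a x y; rewrite scaler_sumr -big_split; apply: eq_bigr => j _ /=.
  by rewrite linearP !ffunE linearP.
apply: (@retract_ses _ _ _ _ u g s sesu) => z.
rewrite sE linear_sum; under eq_bigr do rewrite hE.
rewrite -linear_sum -[RHS]ri; congr (r _); apply/ffunP => k.
rewrite sum_ffunE (bigD1 k) //= ffunE eqxx big1 ?addr0 // => j jk.
by rewrite ffunE eq_sym (negPf jk).
Qed.

(* If T has projective dimension p, then the p-th cosyzygy Z of M satisfies
   Ext^j(T, Z) = Ext^(j+p)(T, M) = 0 for j > 0, so the rest of the
   coresolution splits. *)
Lemma shorten_coresolution T P d (aug : {linear P 0%N -> T}) p r M :
  is_proj_resolution d aug -> (forall k, ext_vanish d k T) ->
  (forall k, (p <= k)%N -> ext_vanish d k M) ->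
  coresolution_by (summand T) r M ->
  exists s, (s <= p)%N /\ coresolution_by (summand T) s M.
Proof.
move=> res extT; elim: r M p => [|r IHr] M p extM /=; first by exists 0%N.
move=> [W [Z [sesM sumW corZ]]].
(* The truncated predecessor keeps the induction going at [p = 0], where all positive Ext groups
   already vanish. *)
have extZ k : (p.-1 <= k)%N -> ext_vanish d k Z.
  move=> lepk; apply: (ext_vanish_quotient res sesM).
    exact: ext_vanish_summand sumW (extT k).
  by apply: extM; exact: leq_trans (leqSpred p) _.
have [s [les corsZ]] := IHr Z _ extZ corZ.
(* For positive [p] there is room to prepend [W]. For [p = 0] the cosyzygy [Z] is itself in add(T),
   so the sequence splits and [M] is a summand too. *)
case: p extM extZ les => [|p] extM extZ les; last first.
  by exists s.+1; split=> //=; exists W, Z.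
exists 0%N; split=> //=; move: les; rewrite leqn0 => /eqP s0.
rewrite s0 /= in corsZ.
have retM := ses_split_summand res sesM (extM 0%N isT) corsZ.
by have [m retW] := sumW; exists m; exact: retract_trans retM retW.
Qed.

(** * Projective resolutions built from bounds on the projective dimension *)

Definition zero_module : lmodType A := {ffun 'I_0 -> A^o}.

Lemma zero_moduleP : zero_mod zero_module.
Proof. by move=> x; apply/ffunP => -[]. Qed.

Definition stalk X (i : nat) : lmodType A := if i is _.+1 then zero_module else X.

Definition stalk_map X i : {linear stalk X i.+1 -> stalk X i} := \0.

Lemma good_resolution_stalk X : projective_mod X ->
  good_resolution (stalk_map X) (idfun : {linear stalk X 0 -> X}).
Proof.
move=> projX; split; last first.
  move=> k; exists zero_module, idfun, \0; split=> //; first by move=> y; exists y.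
  by move=> x y _; rewrite [x]zero_moduleP [y]zero_moduleP.
split.
- case=> //= Y Z g f surjg; exists \0 => x.
  by rewrite (zero_moduleP x : x = 0) !linear0.
- by move=> y; exists y.
- by move=> x; split=> /= [-> | [z <-]] //; exists 0.
- by move=> i x; split=> // _; exists 0; rewrite [x]zero_moduleP.
Qed.

Definition splice_obj N P (i : nat) : lmodType A := if i is j.+1 then P j else N.

Definition splice N P (d : forall i, {linear P i.+1 -> P i})
    (c : {linear P 0%N -> N}) i :
    {linear splice_obj N P i.+1 -> splice_obj N P i} :=
  match i return {linear splice_obj N P i.+1 -> splice_obj N P i} with
  | 0 => c
  | j.+1 => d j
  end.

(** Since [aug] is onto and [u] is injective, [u \o aug] has the image of [u] and the kernel of
    [aug]; its factorization through [K] is the new syzygy. *)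
Lemma good_resolution_splice K N X (u : {linear K -> N}) (g : {linear N -> X})
    P d (aug : {linear P 0%N -> K}) :
  ses u g -> projective_mod N -> good_resolution d aug ->
  good_resolution (splice d (u \o aug)) (g : {linear splice_obj N P 0 -> X}).
Proof.
move=> [inju surjg exu] projN [[projP surja exa exd] fact]; split; last first.
  by case=> [|k]; [exists K, aug, u | exact: fact].
split=> //; first by case.
- move=> x; rewrite exu; split=> [[z <-]|[z <-]]; last by exists (aug z).
  by have [y <-] := surja z; exists y.
- case=> [|i] x; last exact: exd.
  by rewrite -exa /=; split=> [|->]; rewrite ?linear0 // -(linear0 u) => /inju.
Qed.

Lemma projdim_resolution X p : projdim_le X p ->
  exists P (d : forall i, {linear P i.+1 -> P i}) (aug : {linear P 0%N -> X}),
    good_resolution d aug /\ forall k, (p <= k)%N -> zero_mod (P k.+1).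
Proof.
elim: p X => [|p IHp] X /=.
  move=> [_ projX]; exists (stalk X), (stalk_map X), idfun.
  by split=> [|k _]; [exact: good_resolution_stalk | exact: zero_moduleP].
move=> [N [K [[u [g sesu]] [_ projN] /IHp[P [d [aug [res zeroP]]]]]]].
exists (splice_obj N P), (splice d (u \o aug)), g.
by split=> [|[]] //; exact: good_resolution_splice.
Qed.

(** Vanishing is tested in the very resolution that gets shortened, so resolutions need not be
    compared. The last term is a summand of a power of [A], so vanishing passes to it. *)
Lemma projdim_lower X k : projdim_le X k.+1 ->
  exists P (d : forall i, {linear P i.+1 -> P i}) (aug : {linear P 0%N -> X}),
    good_resolution d aug /\
    (ext_vanish d k (A^o : lmodType A) -> projdim_le X k).
Proof.
elim: k X => [|k IHk] X; last first.
  move=> [N [K [[u [g sesu]] [fgN projN] /IHk[P [d [aug [res lowK]]]]]]].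
  exists (splice_obj N P), (splice d (u \o aug)), g.
  split=> [|extA]; first exact: good_resolution_splice.
  by exists N, K; split=> //; [exists u, g | exact: lowK].
move=> /= [N [K [[u [g sesu]] [fgN projN] [fgK projK]]]].
have goodK := good_resolution_stalk projK.
exists (splice_obj N (stalk K)), (splice (stalk_map K) (u \o idfun)), g.
split=> [|/(ext_vanish_summand (fingen_projective_summand fgK projK)) extK].
  exact: good_resolution_splice sesu projN goodK.
(* The identity of the last term [K] is a cocycle; writing it as a coboundary gives a retraction of
   [u], so [X] is a retract of [N]. *)
have [//|r rE] := extK idfun.
have retX := retract_ses_quotient sesu (fun x => esym (rE x)).
have [_ surjg _] := sesu.
by split; [exact: surj_fingen surjg fgN | exact: retract_projective retX projN].
Qed.

Lemma injdim_le_iso X Y q : iso X Y -> injdim_le Y q -> injdim_le X q.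
Proof.
move=> [f bijf]; have injf := bij_inj bijf; case: bijf => h fh hf.
case: q => [|q] /=.
  move=> [fgY injY].
  have [|h' h'E] := @linear_mk A _ _ h.
    by move=> a x y; apply: injf; rewrite linearP !hf.
  split.
    by apply: (surj_fingen (g := h')) fgY => x; exists (f x); rewrite h'E.
  move=> M N u c inju; have [l lE] := injY _ _ u (f \o c) inju.
  by exists (h' \o l) => x; rewrite /= lE /= h'E.
move=> [N [K [[u [g [inju surjg exu]]] injN corK]]].
exists N, K; split=> //; exists (u \o f), g; split=> //; first exact: inj_comp.
move=> x; rewrite exu; split=> [[z <-]|[z <-]]; last by exists (f z).
by exists (h z); rewrite /= hf.
Qed.

End Ext.

Theorem theorem2p10 (R : comNzRingType) (A : algType R)
  (n : nat) (e : 'I_n -> A)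
  (artinA : artin_algebra A)
  (idemA : complete_primitive_orthogonal e)
  (basicA : basic_algebra e)
  (stratA : properly_stratified e)
  (T S : lmodType A)
  (tiltT : tilting T) (basicT : basic_mod T)
  (addT : forall M : lmodType A,
     add_class T M <-> filtered_by (standard e) M /\ filtered_by (proper_costandard e) M)
  (cotiltS : cotilting S) (basicS : basic_mod S)
  (addS : forall M : lmodType A,
     add_class S M <-> filtered_by (costandard e) M /\ filtered_by (proper_standard e) M)
  (isoTS : iso T S) :
  exists p q : nat,
    [/\ projdim T p, injdim T q &
        exists d : nat, findim A d /\ (d <= p + q)%N].
Proof.
have [_ /ex_min[p pdT] extT [r corA]] := tiltT.
have [_ [q0 idS] _ _] := cotiltS.
(* Finite injective dimension of the cotilting [S] passes to [T] along the isomorphism. *)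
have /ex_min[q idT] : exists q, injdim_le T q by exists q0; exact: injdim_le_iso isoTS idS.
exists p, q; split=> //.
have [s [lesp {}corA]] : exists s, (s <= p)%N /\ coresolution_by (summand T) s A^o.
  have [P [d [aug [[res _] zeroP]]]] := projdim_resolution pdT.1.
  apply: (shorten_coresolution (d := d) res) => [k|k lepk|].
  - exact: extT res.
  (* Beyond degree [p] the resolution of [T] is zero, so every cochain there is zero. *)
  - move=> f _; exists \0 => z; by rewrite [z]zeroP ?linear0.
  - exact: coresolution_by_mono (@add_class_summand _ T) corA.
suff ub : findim_ub A (p + q).
  have /ex_min[d [ubd mind]] : exists b, findim_ub A b by exists (p + q)%N.
  by exists d; split; [split | exact: mind].
move=> X [//|d] fgX [pdX mind]; rewrite leqNgt; apply/negP => ltd.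
have [P [D [aug [goodD lower]]]] := projdim_lower pdX.
have [res _] := goodD.
(* Ext^(d+1)(X, A) = 0 would lower the projective dimension [d.+1] to [d], against minimality. *)
suff /lower/mind : ext_vanish D d (A^o : lmodType A) by rewrite ltnn.
apply: (ext_vanish_coresolution (q := q) res _ corA); last first.
  by rewrite addnC (leq_trans _ (ltd : (p + q <= d)%N)) // leq_add2r.
move=> W k sumW leqk; apply: (ext_vanish_summand sumW).
(* A second shift, along the injective coresolution of [T]: the bound starts at [0] for injectives
   and rises to [q]. *)
apply: (ext_vanish_coresolution (q := 0) res _ idT.1 leqk) => I j [_ injI] _.
exact: ext_vanish_injective goodD injI.
Qed.
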